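(* Let $k\ge 2$. In any deterministic one-way number-on-the-forehead protocol for $\textsc{mpj}_k$ in which every player is collapsing, some player must communicate at least $n - \frac12\log n - 2$ bits.
   Context: Logarithms are base $2$; $[n]=\{1,\dots,n\}$. $\textsc{mpj}_k:[n]\times([n]^{[n]})^{k-2}\times\{0,1\}^n\to\{0,1\}$ is given by $\textsc{mpj}_k(i,f_2,\ldots,f_{k-1},x) = x_{f_{k-1}\circ\cdots\circ f_2(i)}$, where $x_r$ is the $r$th bit of $x$. Write the input as $(z_1,\dots,z_k)$ with $z_1=i$, $z_j=f_j$ for $2\le j\le k-1$, $z_k=x$. In the number-on-the-forehead (NOF) model, $z_j$ is on player $j$'s forehead and she sees all $z_h$ with $h\ne j$. In a deterministic one-way protocol, players $1,2,\dots,k$ each write exactly one message on a public blackboard in this order, each message being a deterministic function of what the player sees and the earlier messages, and player $k$'s message must equal $\textsc{mpj}_k$ of the input. Player $j$ is called collapsing if her message depends only on the previous messages, on $z_1,\dots,z_{j-1}$, and on the function $g_j(w_1,\dots,w_j) = \textsc{mpj}_k(w_1,\dots,w_j,z_{j+1},\dots,z_k)$; for pointer jumping this means her message depends only on the previous messages, $i,f_2,\dots,f_{j-1}$, and the composition $x\circ f_{k-1}\circ\cdots\circ f_{j+1}$ (a function $[n]\to\{0,1\}$; for $j=k-1$ this is $x$ itself, and for $j=k$ she sees only $i,f_2,\dots,f_{k-1}$ and the messages). *)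

(* Defs.v *)
From HB Require Import structures.
From mathcomp Require Import all_boot all_order all_algebra.
From mathcomp Require Import all_classical all_reals all_analysis.

Set Implicit Arguments.
Unset Strict Implicit.
Unset Printing Implicit Defensive.

Local Open Scope nat_scope.

(* Players are the natural numbers j with 1 <= j <= k.  An input
   (z_1, ..., z_k) = (i, f_2, ..., f_{k-1}, x) of MPJ_k is stored as the triple
   (i, f, x) with f_j = f l for l.+2 = j; the index set [n] is 'I_n. *)
Definition input (n k : nat) : finType :=
  ('I_n * {ffun 'I_(k - 2) -> {ffun 'I_n -> 'I_n}} * {ffun 'I_n -> bool})%type.

Section PointerJumping.
Variables n k : nat.
Implicit Types (z w : input n k) (j h : nat) (b : seq (seq bool)).

Definition start z : 'I_n := z.1.1.
Definition layer z (l : 'I_(k - 2)) : {ffun 'I_n -> 'I_n} := z.1.2 l.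
Definition bits z : {ffun 'I_n -> bool} := z.2.

(* enum 'I_(k - 2) is increasing, so f_2 is applied first and f_{k-1} last. *)
Definition mpj z : bool :=
  bits z (foldl (fun r l => layer z l r) (start z) (enum 'I_(k - 2))).

(* z and z' have the same j-th component (2 <= k, so 1 <> k). *)
Definition same_at j z z' : Prop :=
  [/\ j = 1 -> start z = start z',
      forall l : 'I_(k - 2), l.+2 = j -> layer z l = layer z' l
    & j = k -> bits z = bits z'].

(* (w_1, ..., w_j, z_{j+1}, ..., z_k), for 1 <= j. *)
Definition splice j w z : input n k :=
  (start w,
   [ffun l : 'I_(k - 2) => if l.+2 <= j then layer w l else layer z l],
   if k <= j then bits w else bits z).

(* g_j, which reads only the components w_1, ..., w_j of w. *)
Definition residual j z : input n k -> bool := fun w => mpj (splice j w z).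

(* P j z b is the message of player j on input z when b lists the messages of
   players 1, ..., j-1; what P may use of z is restricted by the predicates
   below. *)
Definition message_functions := nat -> input n k -> seq (seq bool) -> seq bool.

Implicit Type P : message_functions.

(* The messages of players 1, ..., j on input z. *)
Fixpoint board P z j : seq (seq bool) :=
  if j is j'.+1 then rcons (board P z j') (P j z (board P z j')) else [::].

Definition sent P j z : seq bool := P j z (board P z j.-1).

Definition number_on_forehead P : Prop :=
  forall j, 1 <= j <= k -> forall b z z',
    (forall h, 1 <= h <= k -> h <> j -> same_at h z z') ->
    P j z b = P j z' b.

(* Messages may have variable length, but the blackboard must show where each
   one ends: given the previous messages, the possible next messages form a
   prefix-free set.  Fixed-length messages are a special case. *)
Definition self_delimiting P : Prop :=
  forall j, 1 <= j <= k -> forall z z',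
    board P z j.-1 = board P z' j.-1 ->
    prefix (sent P j z) (sent P j z') -> sent P j z = sent P j z'.

Definition one_way_protocol P : Prop :=
  number_on_forehead P /\ self_delimiting P.

Definition computes_mpj P : Prop := forall z, sent P k z = [:: mpj z].

Definition collapsing P j : Prop :=
  forall b z z',
    (forall h, 1 <= h < j -> same_at h z z') ->
    residual j z =1 residual j z' ->
    P j z b = P j z' b.

(* The worst-case number of bits sent by player j. *)
Definition cost P j : nat := \max_(z : input n k) size (sent P j z).

End PointerJumping.

Definition log2 (R : realType) (a : R) : R := (ln a / ln 2)%R.

(* Main.v *)
(** Call [x] and [y] crossing if every pattern in [{0,1}^2] occurs among the
    pairs [(x_r, y_r)]; then any two strings can be written [x \o g] and
    [y \o g] for one common [g].  Among three strings of weight [n/2] some two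
    cross, so a message that takes fewer than [C(n, n/2) / 2] values fails to
    separate some crossing pair.  Going from player 1 to player [k-1], choose a
    crossing pair [(x_j, y_j)] on which player [j] sends the same message, and
    then [f_j] with [x_j \o f_j = x_{j-1}] and [y_j \o f_j = y_{j-1}]: the
    collapsing players before [j] do not notice the change.  In the end player
    [k] gets the same messages on two inputs that differ only in [x] and have
    different values.  Finally [4^n <= 4 n C(n, n/2)^2] turns the bound
    [2 * 2^t >= C(n, n/2)] into [t >= n - (log n) / 2 - 2]. *)
Require Import Defs.
From mathcomp Require Import all_boot all_order all_algebra.
From mathcomp Require Import all_classical all_reals all_analysis.
From mathcomp Require Import zify ring lra.

Set Implicit Arguments.
Unset Strict Implicit.
Unset Printing Implicit Defensive.

Import Order.TTheory GRing.Theory Num.Theory.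

Local Open Scope nat_scope.

(** * Lower bounds for the middle binomial coefficient *)

Lemma expn16_central_bin m : 0 < m -> 16 ^ m <= 4 * m * 'C(m.*2, m) ^ 2.
Proof.
case: m => // m _; elim: m => [|m IHm]; first by rewrite binS bin0 bin1.
set c := 'C(m.+1.*2, m.+1) in IHm *; set d := 'C(m.+2.*2, m.+2).
have rec : m.+2 * d = 2 * (2 * m + 3) * c.
  have d2 : d = 2 * 'C(m.+1.*2.+1, m.+1).
    rewrite /d doubleS binS.
    have -> : 'C(m.+1.*2.+1, m.+2) = 'C(m.+1.*2.+1, m.+1).
      by rewrite -bin_sub; [congr 'C(_, _); lia | lia].
    by rewrite addnn mul2n.
  have := mul_bin_down m.+1.*2.+1 m.+1; rewrite -pred_Sn -/c.
  have -> : m.+1.*2.+1 - m.+1 = m.+2 by lia.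
  rewrite d2 mulnCA => <-; have -> : m.+1.*2.+1 = 2 * m + 3 by lia.
  by rewrite mulnA.
have : 16 * m.+2 ^ 2 * 16 ^ m.+1 <= 16 * m.+2 ^ 2 * (4 * m.+1 * c ^ 2).
  by rewrite leq_mul2l IHm orbT.
have : m.+2 ^ 2 * d ^ 2 = (2 * (2 * m + 3)) ^ 2 * c ^ 2 by rewrite -!expnMn rec.
rewrite (expnS 16 m.+1) => e1 e2.
rewrite -(leq_pmul2l (m := m.+2 ^ 2)) ?expn_gt0 //.
have -> : m.+2 ^ 2 * (4 * m.+2 * d ^ 2) = 4 * m.+2 * (m.+2 ^ 2 * d ^ 2) by ring.
rewrite e1; apply: (@leq_trans (16 * m.+2 ^ 2 * (4 * m.+1 * c ^ 2))).
  by apply: leq_trans e2; rewrite leq_eqVlt; apply/orP; left; apply/eqP; ring.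
have -> : 16 * m.+2 ^ 2 * (4 * m.+1 * c ^ 2) =
  (16 * m.+2 * c ^ 2) * (4 * m.+2 * m.+1) by ring.
have -> : 4 * m.+2 * ((2 * (2 * m + 3)) ^ 2 * c ^ 2) =
  (16 * m.+2 * c ^ 2) * (2 * m + 3) ^ 2 by ring.
(* The two remaining factors differ by exactly 1. *)
by rewrite leq_mul2l; apply/orP; right; nia.
Qed.

Lemma expn4_middle_bin n : 0 < n -> 4 ^ n <= 4 * n * 'C(n, n./2) ^ 2.
Proof.
move=> n0; set m := n./2; have := odd_double_half n; rewrite -/m.
case: (odd n) => /= En.
(* For odd [n] the middle coefficient is half of the next central one. *)
- have -> : n = m.*2.+1 by lia.
  have := @expn16_central_bin m.+1 isT; rewrite doubleS binS.
  have -> : 'C(m.*2.+1, m.+1) = 'C(m.*2.+1, m).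
    by rewrite -bin_sub; [congr 'C(_, _); lia | lia].
  set c := 'C(_, _); rewrite (expnS 16) (expnS 4) -muln2 (mulnC m) expnM -[4 ^ 2]/16.
  move: (16 ^ m) => e; nia.
- have m0 : 0 < m by lia.
  have -> : n = m.*2 by lia.
  have := expn16_central_bin m0.
  set c := 'C(_, _); rewrite -muln2 (mulnC m) expnM -[4 ^ 2]/16.
  move: (16 ^ m) => e; nia.
Qed.

(** * Crossing pairs and collisions of messages *)

Definition crossing n (x y : {ffun 'I_n -> bool}) : Prop :=
  forall a b : bool, exists r, x r = a /\ y r = b.

(** Equal sizes and [A != B] leave a point in each difference. A common point gives the pattern of
    two [true]s and makes the union smaller than [2 * n./2 <= n], so some point lies outside both
    sets. *)
Lemma crossing_indicators n (A B : {set 'I_n}) :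
  #|A| = n./2 -> #|B| = n./2 -> A != B -> ~~ [disjoint A & B] ->
  crossing [ffun r => r \in A] [ffun r => r \in B].
Proof.
move=> cA cB nAB dAB.
have diff (C D : {set 'I_n}) : #|C| = #|D| -> C != D ->
    exists r, r \in C /\ r \notin D.
  move=> cCD nCD; have /subsetPn[r rC rD] : ~~ (C \subset D).
    by apply: contra nCD => sCD; rewrite eqEcard sCD cCD /=.
  by exists r.
case=> -[].
- move: dAB; rewrite -finset.setI_eq0 => /set0Pn[r]; rewrite inE => /andP[rA rB].
  by exists r; rewrite !ffunE.
- have [r [rA /negbTE rB]] := diff A B (etrans cA (esym cB)) nAB.
  by exists r; rewrite !ffunE.
- rewrite eq_sym in nAB.
  have [r [rB /negbTE rA]] := diff B A (etrans cB (esym cA)) nAB.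
  by exists r; rewrite !ffunE.
- have /card_gt0P[r] : 0 < #|~: (A :|: B)|.
    move: dAB; rewrite -finset.setI_eq0 -card_gt0.
    have := cardsC (A :|: B); rewrite card_ord; have := cardsUI A B; lia.
  rewrite !inE negb_or => /andP[/negbTE rA /negbTE rB].
  by exists r; rewrite !ffunE.
Qed.

Lemma crossing_reindex n m (x y : {ffun 'I_m -> bool}) (u v : {ffun 'I_n -> bool}) :
  crossing u v ->
  exists g : {ffun 'I_m -> 'I_n},
    (forall r, u (g r) = x r) /\ (forall r, v (g r) = y r).
Proof.
move=> cuv; have [g gP] := choice (fun r => cuv (x r) (y r)).
by exists [ffun r => g r]; split=> r; rewrite ffunE; case: (gP r).
Qed.

(** The indicator takes both values. This serves to show that a message considered hypothetically is
    really sent on some input. *)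
Lemma indicator_reindex n m (x : {ffun 'I_m -> bool}) (A : {set 'I_n}) :
  1 < n -> #|A| = n./2 ->
  exists g : {ffun 'I_m -> 'I_n}, forall r, [ffun s => s \in A] (g r) = x r.
Proof.
move=> n1 cA.
have A0 : exists r, r \in A by apply/card_gt0P; lia.
have C0 : exists r, r \notin A.
  have /card_gt0P[r] : 0 < #|~: A|.
    by have := cardsC A; rewrite card_ord; lia.
  by rewrite inE; exists r.
case: A0 => r1 r1A; case: C0 => r0 /negbTE r0A.
exists [ffun r => if x r then r1 else r0] => r; rewrite !ffunE.
by case: (x r).
Qed.

(* Padding all messages of a prefix-free family to length [t] keeps them
   distinct, so there are at most [2 ^ t] of them and some three sets share
   one; three sets of size [n./2] cannot be pairwise disjoint. *)
Lemma crossing_collision n t (msg : {ffun 'I_n -> bool} -> seq bool) :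
  3 < n -> 2 * 2 ^ t < 'C(n, n./2) ->
  (forall A : {set 'I_n}, #|A| = n./2 -> size (msg [ffun r => r \in A]) <= t) ->
  (forall A B : {set 'I_n}, #|A| = n./2 -> #|B| = n./2 ->
     prefix (msg [ffun r => r \in A]) (msg [ffun r => r \in B]) ->
     msg [ffun r => r \in A] = msg [ffun r => r \in B]) ->
  exists x y, crossing x y /\ msg x = msg y.
Proof.
move=> n3 many short pfree.
pose M := [set A : {set 'I_n} | #|A| == n./2].
pose pad (A : {set 'I_n}) := [tuple nth false (msg [ffun r => r \in A]) l | l < t].
have padI A B : A \in M -> B \in M -> pad A = pad B ->
    msg [ffun r => r \in A] = msg [ffun r => r \in B].
  (* Of two messages with equal paddings, the shorter is a prefix of the longer. *)
  wlog le_sz : A B / size (msg [ffun r => r \in A]) <=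
                     size (msg [ffun r => r \in B]).
    move=> wl; have [/wl//|/ltnW/wl wl' AM BM e] :=
      leqP (size (msg [ffun r => r \in A])) (size (msg [ffun r => r \in B])).
    by rewrite wl'.
  rewrite !inE => /eqP cA /eqP cB e; apply: pfree => //.
  rewrite prefixE eq_sym; apply/eqP/(@eq_from_nth _ false).
    by rewrite size_takel.
  move=> l ls; rewrite nth_take //.
  have lt : l < t by apply: leq_trans ls (short _ cA).
  by have := congr1 (fun c => tnth c (Ordinal lt)) e; rewrite !tnth_mktuple.
have cM : #|M| = 'C(n, n./2) by rewrite card_draws card_ord.
have [c] : exists c, 2 < #|[set A in M | pad A == c]|.
  apply/not_existsP => small; move: many; rewrite -cM ltnNge => /negP; apply.
  have -> : #|M| = \sum_(c : t.-tuple bool) #|[set A in M | pad A == c]|.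
    rewrite -sum1_card (partition_big pad predT) //=; apply: eq_bigr => c _.
    by rewrite -[RHS]sum1_card; apply: eq_bigl => A; rewrite !inE.
  have -> : 2 * 2 ^ t = \sum_(c : t.-tuple bool) 2.
    by rewrite sum_nat_const card_tuple card_bool mulnC.
  by apply: leq_sum => c _; rewrite leqNgt; apply/negP.
move=> /card_gt2P[A [B [C [[]]]]].
rewrite !inE => /andP[/eqP cA /eqP pA] /andP[/eqP cB /eqP pB].
move=> /andP[/eqP cC /eqP pC] [nAB nBC nCA].
have found (D E : {set 'I_n}) : #|D| = n./2 -> #|E| = n./2 -> D != E ->
    pad D = c -> pad E = c -> ~~ [disjoint D & E] ->
    exists x y, crossing x y /\ msg x = msg y.
  move=> cD cE nDE pD pE dDE.
  exists [ffun r => r \in D], [ffun r => r \in E]; split.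
    exact: crossing_indicators.
  by apply: padI; rewrite ?inE ?cD ?cE ?pD ?pE.
have [dAB|] := boolP [disjoint A & B]; last exact: found.
have [dBC|] := boolP [disjoint B & C]; last exact: found.
have [dCA|] := boolP [disjoint C & A]; last exact: found.
(* Pairwise disjointness would give [3 * n./2 <= n], impossible for [3 < n] but possible for
   [n = 3]. *)
have := max_card (A :|: B :|: C); rewrite card_ord.
have := cardsUI A B; have := cardsUI (A :|: B) C.
move: dAB dBC dCA; rewrite -!finset.setI_eq0 => /eqP dAB /eqP dBC /eqP dCA.
rewrite finset.setIUl (finset.setIC A C) dCA dBC dAB finset.setU0 !cards0; lia.
Qed.

(** * Two indistinguishable inputs, built layer by layer *)

Section Adversary.
Variables n k : nat.
Hypothesis n3 : 3 < n.
Implicit Types (i : 'I_n) (f : {ffun 'I_(k - 2) -> {ffun 'I_n -> 'I_n}}).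
Implicit Types (x y w : {ffun 'I_n -> bool}) (g : {ffun 'I_n -> 'I_n}).
Implicit Types (q l : 'I_(k - 2)).

(** Both paths agree up to layer [q]. There [f' q] followed by [w] reads [x], while [f q] and all
    later layers on both sides are identities. *)
Lemma mpj_reindex f f' q x w i :
  (forall l, l < q -> f' l = f l) ->
  (forall l, q <= l -> f l =1 id) -> (forall l, q < l -> f' l =1 id) ->
  (forall r, w (f' q r) = x r) ->
  mpj ((i, f', w) : input n k) = mpj ((i, f, x) : input n k).
Proof.
move=> lo hi hi' e; rewrite /mpj /bits /layer /start /=.
have := val_enum_ord (k - 2); have := mem_enum 'I_(k - 2) q.
rewrite inE; case/splitPr => s1 s2 iotaE.
have : pairwise ltn (map val (s1 ++ q :: s2)).
  by rewrite iotaE -sorted_pairwise ?iota_ltn_sorted //; exact: ltn_trans.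
rewrite pairwise_map pairwise_cat allrel_consr /=.
move=> /and4P[/andP[/allP s1q _] _ /allP qs2 _].
rewrite !foldl_cat /=.
have idl (h : {ffun 'I_(k - 2) -> {ffun 'I_n -> 'I_n}}) r :
    {in s2, forall l, h l =1 id} -> foldl (fun r l => h l r) r s2 = r.
  elim: s2 r {iotaE qs2} => //= l s IHs r hid.
  by rewrite hid ?mem_head // IHs // => l' l's; apply: hid; rewrite inE l's orbT.
rewrite !idl; first last.
- by move=> l /qs2 /= /hi'.
- by move=> l /qs2 /= /ltnW /hi.
rewrite e (hi q) //; congr (x _).
elim: s1 i s1q {iotaE} => //= l s IHs r sq.
rewrite lo; last by apply: (sq l); rewrite mem_head.
by apply: IHs => l' l's; apply: sq; rewrite inE l's orbT.
Qed.

Definition set_layer f q g :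
  {ffun 'I_(k - 2) -> {ffun 'I_n -> 'I_n}} :=
  [ffun l => if l == q then g else f l].

(** Layer [q] belongs to player [q.+2], so for [h <= q.+1] [splice] overwrites neither it nor the
    last component, and the two changes cancel. *)
Lemma residual_set_layer f q g x w i h :
  h <= q.+1 -> (forall l, q <= l -> f l =1 id) -> (forall r, w (g r) = x r) ->
  residual h ((i, set_layer f q g, w) : input n k) =1
  residual h ((i, f, x) : input n k).
Proof.
move=> hq hi e z; rewrite /residual /splice /bits /layer /=.
have -> : k <= h = false by have := ltn_ord q; lia.
apply: (@mpj_reindex _ _ q) => [l lq|l ql|l ql|r]; rewrite !ffunE.
- by have -> : l == q = false by apply/negbTE; rewrite -val_eqE /=; lia.
- by have -> : l.+2 <= h = false by [lia]; exact: hi.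
- have -> : l.+2 <= h = false by lia.
  have -> : l == q = false by apply/negbTE; rewrite -val_eqE /=; lia.
  exact/hi/ltnW.
- by have -> : q.+2 <= h = false by [lia]; rewrite eqxx e.
Qed.

Variable P : message_functions n k.
Hypothesis nofP : number_on_forehead P.
Hypothesis delimP : self_delimiting P.
Hypothesis collP : forall j, 1 <= j <= k -> collapsing P j.

Lemma board_set_layer f q g x w i h :
  h <= q.+1 -> (forall l, q <= l -> f l =1 id) -> (forall r, w (g r) = x r) ->
  board P (i, set_layer f q g, w) h = board P (i, f, x) h.
Proof.
move=> + hi e; elim: h => //= h IHh hq; rewrite IHh; last exact: ltnW.
congr (rcons _ _); apply: collP.
- by have := ltn_ord q; lia.
- move=> h' /andP[h'1 h'h]; split=> //= [l lh|hk].
  + rewrite /layer /= ffunE.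
    by have -> : l == q = false by apply/negbTE; rewrite -val_eqE /=; lia.
  + by have := ltn_ord q; lia.
- exact: residual_set_layer.
Qed.

(** Layer [q] is on the forehead of player [q.+2], so her message for [w] is known before [g] is
    chosen. *)
Lemma message_set_layer f q g w i b :
  P q.+2 (i, set_layer f q g, w) b = P q.+2 (i, f, w) b.
Proof.
apply: nofP; first by have := ltn_ord q; lia.
move=> h _ hq; split=> // l lh; rewrite /layer /= ffunE.
by have -> : l == q = false by apply/negbTE; rewrite -val_eqE /=; lia.
Qed.

Variable t : nat.
Hypothesis costP : forall j, 1 <= j <= k -> cost P j <= t.
Hypothesis many : 2 * 2 ^ t < 'C(n, n./2).

Lemma size_sent j z : 1 <= j <= k -> size (sent P j z) <= t.
Proof.
move=> jk; apply: leq_trans (costP jk).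
exact: (leq_bigmax (F := fun z => size (sent P j z)) z).
Qed.

(* The layers not yet chosen are the identity, so [x] and [y] play the part of
   the collapsed functions that player [j.+1] sees. *)
Lemma fooling_pair j : j.+1 < k ->
  exists i f x y,
    [/\ crossing x y, forall l, j <= l -> f l =1 id,
        board P (i, f, x) j.+1 = board P (i, f, y) j.+1
      & mpj ((i, f, x) : input n k) != mpj ((i, f, y) : input n k)].
Proof.
elim: j => [|j IHj] jk.
- pose f0 : {ffun 'I_(k - 2) -> {ffun 'I_n -> 'I_n}} := [ffun=> [ffun r => r]].
  have n0 : 0 < n by lia.
  have r1 : 1 <= 1 <= k by lia.
  pose msg w := P 1 (Ordinal n0, f0, w) [::].
  have [||x [y [cxy exy]]] := @crossing_collision n t msg n3 many.
  + by move=> A _; exact: (size_sent _ r1).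
  + by move=> A B _ _; apply: (delimP r1).
  have [i [xi yi]] := cxy true false.
  have f0id l : f0 l =1 id by move=> r; rewrite !ffunE.
  (* The pointer [i] is chosen after [x] and [y]; [residual 1] discards it, so player 1 sends the
     same message. *)
  have start_indep w : P 1 (i, f0, w) [::] = msg w.
    apply: (collP r1) => [h|z]; first by case/andP => /leq_ltn_trans /[apply].
    by [].
  exists i, f0, x, y; split=> //=; first by rewrite !start_indep exy.
  rewrite /mpj /bits /layer /start /=.
  have foldl_id r s : foldl (fun r l => f0 l r) r s = r.
    by elim: s r => //= l s IHs r; rewrite f0id.
  by rewrite !foldl_id xi yi.
have [i [f [x [y [_ fid bxy nxy]]]]] := IHj (ltnW jk).
have jq : j < k - 2 by lia.
pose q := Ordinal jq.
have r1 : 1 <= q.+2 <= k by rewrite /=; lia.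
set b := board P (i, f, x) j.+1 in bxy.
pose msg w := P j.+2 (i, f, w) b.
(* [msg w] presupposes the blackboard [b]. If [w \o g] is [x], taking [g] as layer [q] makes [b] the
   actual blackboard, so the cost and prefix hypotheses apply to [msg w]. *)
have sentE g w : (forall r, w (g r) = x r) ->
    sent P j.+2 (i, set_layer f q g, w) = msg w.
  move=> e; rewrite /sent -pred_Sn (@board_set_layer f q g x) //.
  exact: (message_set_layer f q).
have [A cA|A B cA cB|w [v [cwv ewv]]] := @crossing_collision n t msg n3 many.
- have [|g gP] := indicator_reindex x _ cA; first by lia.
  by rewrite -(sentE g) //; exact: size_sent.
- have [|g gP] := indicator_reindex x _ cA; first by lia.
  have [|g' g'P] := indicator_reindex x _ cB; first by lia.
  rewrite -(sentE g) // -(sentE g') //; apply: delimP => //.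
  by rewrite -pred_Sn !(@board_set_layer f q _ x).
have [g [gw gv]] := crossing_reindex x y cwv.
exists i, (set_layer f q g), w, v; split=> //.
- move=> l jl; rewrite ffunE.
  have -> : l == q = false by apply/negbTE; rewrite -val_eqE /=; lia.
  exact/fid/ltnW.
(* The first [j.+1] messages agree by induction, the next one by the collision. *)
- have boardS z : board P z j.+2 =
    rcons (board P z j.+1) (P j.+2 z (board P z j.+1)) by [].
  rewrite !boardS (@board_set_layer f q g x) // (@board_set_layer f q g y) //.
  have mE u : P j.+2 (i, set_layer f q g, u) b = msg u.
    exact: (message_set_layer f q).
  by rewrite -bxy -/b !mE ewv.
- have mE (u u' : {ffun 'I_n -> bool}) : (forall r, u (g r) = u' r) ->
      mpj ((i, set_layer f q g, u) : input n k) = mpj ((i, f, u') : input n k).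
    move=> e; apply: (@mpj_reindex _ _ q) => [l lq|//|l ql|r]; rewrite ffunE.
    + by case: eqP lq => // ->; rewrite ltnn.
    + case: eqP ql => [->|_ ql]; first by rewrite ltnn.
      exact/fid/ltnW.
    + by rewrite eqxx.
  by rewrite (mE w x) // (mE v y).
Qed.

Lemma not_computes_mpj : 2 <= k -> ~ computes_mpj P.
Proof.
move=> hk comp; have jk : (k - 2).+1 < k by lia.
have [i [f [x [y [_ _ bxy /eqP nxy]]]]] := fooling_pair jk; apply: nxy.
have cx := comp (i, f, x); have := comp (i, f, y); move: cx; rewrite /sent.
have -> : k.-1 = (k - 2).+1 by lia.
rewrite bxy (@nofP k _ _ (i, f, x) (i, f, y)); first by move=> -> [].
- by lia.
- by move=> h _ hk'; split.
Qed.

End Adversary.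

(** * From binomial coefficients to the logarithmic bound *)

Lemma log2_ge0 (R : realType) n : 0 < n -> (0 <= log2 (n%:R : R))%R.
Proof.
by move=> n0; rewrite /log2 divr_ge0 // ln_ge0 // ?ler1n.
Qed.

Lemma lt_middle_bin (R : realType) n t : 0 < n ->
  (t%:R < n%:R - 1 / 2 * log2 n%:R - 2 :> R)%R -> 2 * 2 ^ t < 'C(n, n./2).
Proof.
move=> n0 lt.
have l2 : (0 < ln (2 : R))%R by rewrite ln_gt0 // ltr1n.
have n0R : (0 < n%:R :> R)%R by rewrite ltr0n.
(* This is [2 t + log n + 4 < 2 n], exponentiated in base 2. *)
have key : 16 * n * 4 ^ t < 4 ^ n.
  rewrite -(ltr_nat R) !natrM !natrX -ltr_ln ?posrE ?mulr_gt0 ?exprn_gt0 ?ltr0n //.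
  rewrite !lnM ?posrE ?mulr_gt0 ?exprn_gt0 ?ltr0n // !lnXn ?ltr0n //.
  have -> : (16%:R = 2 ^+ 4 :> R)%R by ring.
  have -> : (4%:R = 2 ^+ 2 :> R)%R by ring.
  rewrite !lnXn ?ltr0n //.
  move: lt; rewrite /log2; set L := ln (n%:R : R).
  have : (L = L / ln 2 * ln 2)%R by rewrite divfK // gt_eqF.
  move: (L / ln 2)%R => u -> lt.
  have : (0 < (n%:R - 1 / 2 * u - 2 - t%:R) * ln (2 : R))%R.
    by rewrite mulr_gt0 // subr_gt0.
  rewrite -(mulr_natr _ t) -(mulr_natr _ n) -!(mulr_natr (ln 2)); lra.
have := expn4_middle_bin n0; set c := 'C(_, _) => bnd.
have : 4 * n * (2 * 2 ^ t) ^ 2 < 4 * n * c ^ 2.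
  apply: leq_trans bnd; apply: leq_trans key; rewrite ltnS leq_eqVlt.
  have -> : 4 ^ t = (2 ^ t) ^ 2 by rewrite -expnM mulnC expnM.
  by apply/orP; left; apply/eqP; ring.
by rewrite ltn_pmul2l ?ltn_sqr //; lia.
Qed.

Theorem theorem1p4 (R : realType) (n k : nat) (hn : (0 < n)%N) (hk : (2 <= k)%N)
    (P : message_functions n k) :
  one_way_protocol P ->
  computes_mpj P ->
  (forall j : nat, (1 <= j <= k)%N -> collapsing P j) ->
  exists2 j : nat, (1 <= j <= k)%N &
    (n%:R - 1 / 2 * log2 n%:R - 2 <= (cost P j)%:R :> R)%R.
Proof.
move=> [nofP delimP] comp collP.
have [n_le3|n3] := leqP n 3.
  (* For [n <= 3] the bound is at most 1, and the answer of player [k] is already one bit. *)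
  exists k; first by lia.
  have c1 : (1 <= (cost P k)%:R :> R)%R.
    rewrite ler1n.
    pose z : input n k := (Ordinal hn, [ffun=> [ffun r => r]], [ffun=> true]).
    have := leq_bigmax (F := fun z => size (sent P k z)) z.
    by rewrite comp.
  have := log2_ge0 R hn.
  have : (n%:R <= 3 :> R)%R by rewrite ler_nat.
  lra.
apply: contrapT => cheap; pose t := \max_(j < k) cost P j.+1.
have costP j : 1 <= j <= k -> cost P j <= t.
  case: j => // j jk; exact: (leq_bigmax (F := fun j : 'I_k => cost P j.+1) (Ordinal jk)).
apply: (not_computes_mpj n3 nofP delimP collP costP _ hk comp).
apply: (@lt_middle_bin R) hn _.
have [|j tE] := @bigop.eq_bigmax _ (fun j : 'I_k => cost P j.+1).
  by rewrite card_ord; lia.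
rewrite /t tE ltNge; apply/negP => le_cost; apply: cheap.
by exists j.+1 => //; exact: ltn_ord.
Qed.
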